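(* Let $G$ be a finitely generated group and let $N\trianglelefteq G$ be a non-trivial finitely generated normal subgroup. Then $N$ is realizable in $G$ if and only if the quotient group $G/N$ admits a strongly aperiodic subshift of finite type.
   Context: Let $K$ be a group and $A$ a non-empty finite set. $K$ acts on $A^K=\{x:K\to A\}$ by $(g\cdot x)(h)=x(g^{-1}h)$. A pattern is a map $p:F\to A$ with $F\subset K$ finite; it appears in $x\in A^K$ if there is $g\in K$ with $p(h)=x(gh)$ for all $h\in F$. A $K$-subshift is a set $X\subseteq A^K$ consisting of exactly those configurations in which no pattern of some given set $\mathcal F$ of patterns appears; it is a subshift of finite type ($K$-SFT) if $\mathcal F$ can be chosen finite. For $x\in A^K$, $\mathrm{stab}(x)=\{g\in K: g\cdot x=x\}$, and $\mathrm{stab}(X)=\{\mathrm{stab}(x): x\in X\}$. A subgroup $H\le K$ is realizable in $K$ if there exist a finite alphabet $A$ and a non-empty $K$-SFT $X\subseteq A^K$ with $\mathrm{stab}(X)=\{H\}$. A $K$-subshift is strongly aperiodic if it is non-empty and $\mathrm{stab}(x)=\{1_K\}$ for every $x\in X$. *)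

(* Defs.v *)
(* Groups may be infinite: they are [groupType]s, their subsets are classical sets. *)
From HB Require Import structures.
From mathcomp Require Import all_boot generic_quotient finmap.
From mathcomp Require Import boolp classical_sets cardinality.

Set Implicit Arguments.
Unset Strict Implicit.
Unset Printing Implicit Defensive.

Local Open Scope classical_set_scope.
Local Open Scope group_scope.

Section Subgroups.
Variable K : groupType.

Definition is_subgroup (H : set K) : Prop := group_closed (mem H).

Lemma is_subgroupP (H : set K) :
  is_subgroup H <->
  [/\ H 1, forall g h, H g -> H h -> H (g * h) & forall g, H g -> H g^-1].
Proof.
split=> [[/set_mem H1 HB]|[H1 HM HV]].
  have HV g : H g -> H g^-1.
    by move=> Hg; rewrite -[g^-1]mul1g; apply: set_mem; apply: HB; apply/mem_set.
  split=> // g h Hg Hh; rewrite -[h]invgK; apply: set_mem.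
  by apply: HB; apply/mem_set => //; exact: HV.
split=> [|g h /set_mem Hg /set_mem Hh]; apply/mem_set => //.
exact: HM Hg (HV _ Hh).
Qed.

Definition is_normal_subgroup (H : set K) : Prop :=
  is_subgroup H /\ forall n g, H n -> H (n ^ g).

Definition generated (S : set K) : set K := smallest is_subgroup S.

Definition finitely_generated (H : set K) : Prop :=
  exists2 S : set K, finite_set S & generated S = H.

End Subgroups.

Section Quotient.
Variables (K : groupType) (N : set K) (nN : is_normal_subgroup N).

Let subgroup1 : N 1. Proof. by have [/is_subgroupP[]] := nN. Qed.
Let subgroupM g h : N g -> N h -> N (g * h).
Proof. by have [/is_subgroupP[_ + _] _] := nN; exact. Qed.
Let subgroupV g : N g -> N g^-1.
Proof. by have [/is_subgroupP[_ _ +] _] := nN; exact. Qed.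

(* The normality proof is an argument only to let [EquivRel] and the group
   structure below be inferred from the type. *)
Definition coset_rel of is_normal_subgroup N : rel K :=
  fun g h => `[< N (g^-1 * h) >].

Lemma coset_rel_refl : reflexive (coset_rel nN).
Proof. by move=> g; apply/asboolP; rewrite mulVg; exact: subgroup1. Qed.

Lemma coset_rel_sym : symmetric (coset_rel nN).
Proof.
have sym g h : coset_rel nN g h -> coset_rel nN h g.
  move=> /asboolP gh; apply/asboolP.
  by rewrite -[h^-1 * g]invgK invgM invgK; exact: (subgroupV gh).
by move=> g h; apply/idP/idP; exact: sym.
Qed.

Lemma coset_rel_trans : transitive (coset_rel nN).
Proof.
move=> h g k /asboolP gh /asboolP hk; apply/asboolP.
have -> : g^-1 * k = (g^-1 * h) * (h^-1 * k) by rewrite mulgA mulgK.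
exact: (subgroupM gh hk).
Qed.

Canonical coset_equiv :=
  EquivRel (coset_rel nN) coset_rel_refl coset_rel_sym coset_rel_trans.

Definition quotient_group : Type := {eq_quot coset_rel nN}%qT.

HB.instance Definition _ := Choice.on quotient_group.
HB.instance Definition _ := EqQuotient.on quotient_group.

Local Notation Q := quotient_group.
Local Notation piQ := (\pi_quotient_group)%qT.

Lemma pi_coset (g h : K) : (piQ g = piQ h) <-> N (g^-1 * h).
Proof.
by split=> [/eqmodP/asboolP // | gh]; apply/eqmodP/asboolP.
Qed.

Definition quotient_mul : Q -> Q -> Q := lift_op2 Q (@mul K).
Definition quotient_inv : Q -> Q := lift_op1 Q (@inv K).
Definition quotient_one : Q := lift_cst Q 1.

Lemma quotient_mulE : {morph piQ : g h / g * h >-> quotient_mul g h}.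
Proof.
move=> g h; unlock quotient_mul; apply/esym/pi_coset.
set g' := repr _; set h' := repr _.
have Ng : N (g'^-1 * g) by apply/pi_coset; rewrite reprK.
have Nh : N (h'^-1 * h) by apply/pi_coset; rewrite reprK.
have -> : (g' * h')^-1 * (g * h) = (g'^-1 * g) ^ h' * (h'^-1 * h).
  by rewrite /conjg invgM !mulgA mulgK.
exact: (subgroupM (nN.2 _ _ Ng) Nh).
Qed.
Canonical pi_quotient_mul := PiMorph2 quotient_mulE.

Lemma quotient_invE : {morph piQ : g / g^-1 >-> quotient_inv g}.
Proof.
move=> g; unlock quotient_inv; apply/esym/pi_coset; set g' := repr _.
have Ng : N (g^-1 * g') by apply/pi_coset; rewrite reprK.
have -> : g'^-1^-1 * g^-1 = (g^-1 * g') ^ g^-1.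
  by rewrite /conjg !invgK !mulgA mulgV mul1g.
exact: nN.2.
Qed.
Canonical pi_quotient_inv := PiMorph1 quotient_invE.

Canonical pi_quotient_one := PiConst quotient_one.

Lemma quotient_mulA : associative quotient_mul.
Proof. by elim/quotW=> a; elim/quotW=> b; elim/quotW=> c; rewrite !piE mulgA. Qed.

Lemma quotient_mul1g : left_id quotient_one quotient_mul.
Proof. by elim/quotW=> a; rewrite !piE mul1g. Qed.

Lemma quotient_mulg1 : right_id quotient_one quotient_mul.
Proof. by elim/quotW=> a; rewrite !piE mulg1. Qed.

Lemma quotient_mulVg : left_inverse quotient_one quotient_inv quotient_mul.
Proof. by elim/quotW=> a; rewrite !piE mulVg. Qed.

Lemma quotient_mulgV : right_inverse quotient_one quotient_inv quotient_mul.
Proof. by elim/quotW=> a; rewrite !piE mulgV. Qed.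

HB.instance Definition _ := isGroup.Build quotient_group
  quotient_mulA quotient_mul1g quotient_mulg1 quotient_mulVg quotient_mulgV.

Lemma quotient_piM (g h : K) : piQ (g * h) = piQ g * piQ h.
Proof. exact: quotient_mulE. Qed.

Lemma quotient_piV (g : K) : piQ g^-1 = (piQ g)^-1.
Proof. exact: quotient_invE. Qed.

Lemma quotient_pi_eq1 (g : K) : piQ g = 1 <-> N g.
Proof.
have -> : (1 : Q) = piQ 1 by rewrite -[LHS]/quotient_one piE.
rewrite -[X in N X]mul1g -[X in X * g]invg1 -pi_coset.
by split=> /esym.
Qed.

End Quotient.

Section Subshifts.
Variables (K : groupType) (A : finType).
Implicit Types (x : K -> A) (p : {fmap K -> A}) (X : set (K -> A)).

Definition translate (g : K) x : K -> A := fun h => x (g^-1 * h).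

(* A pattern is a finite map: its domain [domf p : {fset K}] is the finite
   support. *)
Definition appears p x : Prop :=
  exists g : K, forall h : domf p, p h = x (g * val h).

Definition avoiding (F : set {fmap K -> A}) : set (K -> A) :=
  [set x | forall p, F p -> ~ appears p x].

Definition is_subshift X : Prop := exists F : set {fmap K -> A}, X = avoiding F.

Definition is_SFT X : Prop :=
  exists2 F : set {fmap K -> A}, finite_set F & X = avoiding F.

Definition stab x : set K := [set g | translate g x = x].

Definition strongly_aperiodic X : Prop :=
  [/\ is_subshift X, X !=set0 & forall x, X x -> stab x = [set 1]].

End Subshifts.

Definition realizable (K : groupType) (H : set K) : Prop :=
  exists (A : finType) (X : set (K -> A)),
    [/\ (0 < #|A|)%N, is_SFT X, X !=set0 & [set stab x | x in X] = [set H]].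

Definition admits_strongly_aperiodic_SFT (K : groupType) : Prop :=
  exists (A : finType) (X : set (K -> A)),
    [/\ (0 < #|A|)%N, is_SFT X & strongly_aperiodic X].

(* Main.v *)
Require Import Defs.
From HB Require Import structures.
From mathcomp Require Import all_boot finmap.
From mathcomp Require Import boolp classical_sets cardinality.

(** Write [piQ] for the projection [G -> G/N].  Composing with [piQ] identifies
the configurations on [G/N] with the configurations on [G] that are constant on
the cosets of [N]; as [N] is normal, left and right cosets agree, so these are
also the configurations fixed by all of [N].  Under this identification the
stabilizer of [y \o piQ] is the preimage of the stabilizer of [y]
([stab_pullback]).  Hence [y] has a trivial stabilizer exactly when the one of
[y \o piQ] is [N], and a set of configurations all of whose stabilizers are [N]
is automatically the pullback of a set of configurations on [G/N].

It remains to see that a set [Y] of configurations on [G/N] is of finite type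
if and only if its pullback is.  Finite type means definable by a local rule:
a condition, seen through a finite window, that has to hold at every position
([is_SFTP]).  A rule for the pullback becomes a rule for [Y] by projecting its
window to [G/N] ([is_SFT_pullback_inv]).  A rule for [Y] becomes a rule for the
pullback by lifting its window to coset representatives and adding the
condition of being constant on cosets; that condition is local because it only
has to be checked between a position and its right translates by finitely many
generators of [N] ([is_SFT_pullback]). *)

Set Implicit Arguments.
Unset Strict Implicit.
Unset Printing Implicit Defensive.

Local Open Scope classical_set_scope.
Local Open Scope group_scope.

Section LocalRules.
Variables (K : groupType) (A : finType).
Implicit Types (x z : K -> A) (W : set K) (P : (K -> A) -> Prop).

Definition local_rule W P : Prop :=
  forall z z', (forall h, W h -> z h = z' h) -> P z -> P z'.

Definition everywhere P : set (K -> A) := [set x | forall g, P (translate g x)].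

(** The forbidden patterns are the colourings of the window that no
configuration satisfying the rule extends: there are finitely many of them
because the alphabet is finite. *)
Lemma everywhere_SFT W P :
  finite_set W -> local_rule W P -> is_SFT (everywhere P).
Proof.
move=> /finite_fsetP[V ->] locP.
pose bad := [set f : {ffun V -> A} |
  forall z, (forall h : V, f h = z (val h)) -> ~ P z].
exists ((fun f => FinMap f) @` bad).
  by apply: finite_image; exact: finite_finset.
apply/seteqP; split=> x /= Hx.
  by move=> _ [f badf <-] [g /= fx]; apply: (badf (translate g^-1 x)) => // h;
    rewrite /translate invgK; exact: fx.
move=> g; apply: contrapT => nP.
pose f := [ffun h : V => translate g x (val h)].
apply: (Hx (FinMap f)); last by exists g^-1 => h /=; rewrite ffunE.
exists f => // z fz Pz; apply: nP; apply: locP Pz => h Vh.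
by rewrite -(fz [` Vh]%fset) ffunE.
Qed.

(** Finitely many forbidden patterns are seen through the union of their
supports, so that local rules can replace sets of patterns. *)
Lemma is_SFTP (X : set (K -> A)) :
  is_SFT X <->
  exists W P, [/\ finite_set W, local_rule W P & X = everywhere P].
Proof.
split=> [[F finF ->]|[W [P [finW locP ->]]]]; last exact: everywhere_SFT locP.
exists (\bigcup_(p in F) [set` domf p]).
exists (fun z => forall p, F p -> ~ forall h : domf p, p h = z (val h)).
split.
- by apply: bigcup_finite => // p _; exact: finite_fset.
- move=> z z' zz' Pz p Fp pz'; apply: (Pz p Fp) => h.
  by rewrite pz' -zz' //; exists p => //=; exact: valP.
- apply/seteqP; split=> x /= Hx.
    by move=> g p Fp px; apply: (Hx p Fp); exists g^-1.
  move=> p Fp [g px]; apply: (Hx g^-1 p Fp) => h.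
  by rewrite /translate invgK.
Qed.

End LocalRules.

(** Right translations that fix [x] form a subgroup, so invariance propagates
from generators. *)
Lemma right_invariant_generated (K : groupType) (T : Type) (x : K -> T)
    (S : set K) :
  (forall g s, S s -> x (g * s) = x g) ->
  forall g n, generated S n -> x (g * n) = x g.
Proof.
move=> xS g n genn.
pose R := [set m | forall k, x (k * m) = x k].
suff: R n by apply.
apply: genn; split=> [|s Ss k]; last exact: xS.
apply/is_subgroupP; split=> [k|a b Ra Rb k|a Ra k]; first by rewrite mulg1.
  by rewrite mulgA Rb.
by rewrite -(Ra (k * a^-1)) -mulgA mulVg mulg1.
Qed.

Section Pullback.
Variables (G : groupType) (N : set G) (nN : is_normal_subgroup N).
Variable A : finType.
Local Notation Q := (quotient_group nN).
Local Notation piQ := (\pi_Q)%qT.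
Implicit Types (x : G -> A) (y : Q -> A) (Y : set (Q -> A)).

Definition pullback y : G -> A := fun g => y (piQ g).

Lemma translate_pullback g y :
  translate g (pullback y) = pullback (translate (piQ g) y).
Proof.
by apply/funext => h; rewrite /translate /pullback quotient_piM quotient_piV.
Qed.

Lemma pullback_inj : injective pullback.
Proof.
move=> y y' yy'; apply/funext => q.
by rewrite -[q]reprK; exact: (congr1 (fun x => x (repr q)) yy').
Qed.

Lemma stab_pullback y : stab (pullback y) = piQ @^-1` stab y.
Proof.
apply/seteqP; split=> g /=; rewrite /stab /= translate_pullback.
  exact: pullback_inj.
by move=> ->.
Qed.

Lemma stab_pullback_eqN y : stab (pullback y) = N <-> stab y = [set 1].
Proof.
rewrite stab_pullback; split=> [stabN|->].
  have stabE g : stab y (piQ g) <-> piQ g = 1.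
    rewrite quotient_pi_eq1.
    by have /= -> := congr1 (fun H : set G => H g) stabN.
  by apply/seteqP; split=> q; rewrite -[q]reprK; move/stabE.
by apply/seteqP; split=> g /= /(quotient_pi_eq1 nN).
Qed.

Lemma right_invariant_pullback x :
  (forall g n, N n -> x (g * n) = x g) -> x = pullback (x \o repr).
Proof.
move=> xN; apply/funext => g; rewrite /pullback /=.
set g' := repr _.
have /xN : N (g^-1 * g') by apply/(pi_coset nN); rewrite reprK.
by move=> /(_ g); rewrite mulVKg.
Qed.

(** An element [n] of the stabilizer acts on the left; normality turns the
right translation [g * n] into the left one [(n ^ g^-1) * g]. *)
Lemma stab_sub_pullback x : N `<=` stab x -> x = pullback (x \o repr).
Proof.
move=> Nx; apply: right_invariant_pullback => g n Nn.
have /Nx : N (n ^ g^-1) by exact: nN.2.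
move=> /(congr1 (fun z => z (g * n))); rewrite /translate => <-.
by rewrite -conjVg /conjg invgK -!mulgA mulKg mulVg mulg1.
Qed.

Lemma is_SFT_pullback_inv Y : is_SFT (pullback @` Y) -> is_SFT Y.
Proof.
move=> /is_SFTP[W [P [finW locP YP]]]; apply/is_SFTP.
exists (piQ @` W), (P \o pullback); split; first exact: finite_image.
  move=> z z' zz'; apply: locP => h Wh.
  by apply: zz'; exists h.
have memY y : Y y <-> everywhere P (pullback y).
  rewrite -YP; split=> [Yy|[y' Yy' /pullback_inj <-//]].
  by exists y.
apply/seteqP; split=> y.
  move=> /memY Py q; rewrite -[q]reprK /= -translate_pullback.
  exact: Py.
by move=> Py; apply/memY => g; rewrite translate_pullback; exact: Py.
Qed.

Lemma is_SFT_pullback Y :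
  finitely_generated N -> is_SFT Y -> is_SFT (pullback @` Y).
Proof.
move=> [S finS genS] /is_SFTP[W [P [finW locP ->]]]; apply/is_SFTP.
exists ([set 1] `|` S `|` repr @` W).
exists (fun x => (forall s, S s -> x s = x 1) /\ P (x \o repr)); split.
- by rewrite !finite_setU; split; [split|exact: finite_image].
- move=> z z' zz' [zS Pz]; split.
    by move=> s Ss; rewrite -!zz' ?zS //; left; [left|right].
  by apply: locP Pz => h Wh; apply: zz'; right; exists h.
have pullbackK y : pullback y \o repr = y.
  by apply/funext => q; rewrite /pullback /= reprK.
apply/seteqP; split=> x.
  move=> [y Py <-] g; rewrite translate_pullback pullbackK; split=> // s Ss.
  have Ns : N s by rewrite -genS => H [_]; apply.
  rewrite /pullback; congr (translate _ _ _); apply/(pi_coset nN).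
  by have [/is_subgroupP[_ _ NV] _] := nN; rewrite mulg1; exact: NV.
move=> Px.
have xE : x = pullback (x \o repr).
  apply: right_invariant_pullback => g n; rewrite -[X in X _]genS.
  apply: right_invariant_generated => h s Ss.
  have [/(_ s Ss) + _] := Px h^-1.
  by rewrite /translate invgK mulg1.
exists (x \o repr) => // q; rewrite -[q]reprK.
have [_] := Px (repr q).
by rewrite [in X in X -> _]xE translate_pullback pullbackK.
Qed.

End Pullback.

Arguments pullback {G N} nN {A} y.

Theorem theorem1 (G : groupType) (N : set G) (nN : is_normal_subgroup N)
    (fgG : finitely_generated [set: G]%classic) (fgN : finitely_generated N)
    (N_neq1 : N <> [set 1%g]%classic) :
  realizable N <-> admits_strongly_aperiodic_SFT (quotient_group nN).
Proof.
split=> [[A [X [A0 sftX [x0 Xx0] stabX]]]|[A [Y [A0 sftY [_ [y0 Yy0] apY]]]]].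
- have stabN x : X x -> stab x = N.
    by move=> Xx; have : [set stab x | x in X] (stab x) by [exists x];
       rewrite stabX.
  have xE x : X x -> x = pullback nN (x \o repr).
    by move=> Xx; apply: stab_sub_pullback; rewrite stabN.
  pose Y := pullback nN @^-1` X.
  have sftY : is_SFT Y.
    apply: is_SFT_pullback_inv; suff -> : pullback nN @` Y = X by [].
    apply/seteqP; split=> [_ [y Yy <-] //|x Xx].
    by exists (x \o repr); rewrite /Y /= -xE.
  exists A, Y; split=> //; split.
  + by have [F _ YF] := sftY; exists F.
  + by exists (x0 \o repr); rewrite /Y /= -xE.
  + by move=> y Yy; apply/stab_pullback_eqN/stabN.
- exists A, (pullback nN @` Y); split=> //.
  + exact: is_SFT_pullback.
  + by exists (pullback nN y0); exists y0.
  + have stabN y : Y y -> stab (pullback nN y) = N.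
      by move=> Yy; apply/stab_pullback_eqN; exact: apY.
    apply/seteqP; split=> [_ [_ [y Yy <-] <-]|_ ->]; first exact: stabN.
    by exists (pullback nN y0); [exists y0|exact: stabN].
Qed.
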